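(* Let $0<\mu<L$, $\kappa=L/\mu$, and let $f:\mathbb{R}^d\to\mathbb{R}$ be $\mu$-strongly convex and $L$-smooth. Consider minimizing $f$ with gradient descent with constant stepsize $\alpha\in(0,2/L)$ subject to deterministic square-summable gradient errors, i.e. $x_{k+1}=x_k-\alpha(\nabla f(x_k)+w_k)$, $k\ge0$. Then $$L_{2,*}\le\begin{cases}\frac{1}{\sqrt{2\mu}} & \text{if } 0<\alpha\le\frac1L,\\ \frac{1}{\sqrt{2\mu}}\frac{\alpha L}{2-\alpha L} & \text{if } \frac1L<\alpha\le\frac{2}{L+\sqrt{L\mu}},\\ \frac{1}{\sqrt{2\mu}}\sqrt\kappa & \text{if } \frac{2}{L+\sqrt{L\mu}}<\alpha\le\frac{2}{L+\mu},\\ \frac{\alpha\sqrt L}{\sqrt2(2-\alpha L)} & \text{if } \frac{2}{L+\mu}<\alpha<\frac2L.\end{cases}$$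
   Context: $L$-smooth means $f$ is continuously differentiable with $L$-Lipschitz gradient; $\mu$-strongly convex means $x\mapsto f(x)-\frac\mu2\|x\|^2$ is convex. $x_*$ is the minimizer of $f$. $\ell_2$ gain (worst-case robustness): $L_{2,*}$ is the infimum of all $\gamma>0$ for which there is a function $\overline H:\mathbb{R}^d\to[0,\infty)$, independent of the error sequence, with $\overline H(x_* )=0$, such that for every initialization $x_0\in\mathbb{R}^d$ and every square-summable $\{w_k\}_{k\ge0}\subset\mathbb{R}^d$, $$\sum_{k\ge0}(f(x_k)-f(x_* ))\le\gamma^2\sum_{k\ge0}\|w_k\|^2+\overline H(x_0).$$ *)

(* Defs.v *)
From HB Require Import structures.
From mathcomp Require Import all_boot all_order all_algebra.
From mathcomp Require Import all_classical all_reals all_analysis.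
Set Implicit Arguments.
Unset Strict Implicit.
Unset Printing Implicit Defensive.
Import Order.TTheory GRing.Theory Num.Theory.
Import numFieldNormedType.Exports.
Local Open Scope classical_set_scope.
Local Open Scope ring_scope.

(* The library norm `|v| on 'rV[R]_d is the sup norm, hence enorm for the
   metric quantities. Differentiability and continuity are insensitive to the
   choice of norm, so the library notions are used for those. *)
Definition enorm (R : realType) (d : nat) (v : 'rV[R]_d) : R :=
  Num.sqrt (\sum_(i < d) v 0 i ^+ 2).

Definition grad (R : realType) (d : nat) (f : 'rV[R]_d -> R) (x : 'rV[R]_d) :
  'rV[R]_d := \row_(i < d) 'D_(delta_mx 0 i) f x.

Definition smooth (R : realType) (d : nat) (L : R) (f : 'rV[R]_d -> R) : Prop :=
  [/\ forall x, differentiable f x,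
      continuous (grad f) &
      forall x y, enorm (grad f x - grad f y) <= L * enorm (x - y)].

Definition strongly_convex (R : realType) (d : nat) (mu : R)
    (f : 'rV[R]_d -> R) : Prop :=
  convex_function [set: convex_lmodType 'rV[R]_d]
    (fun x => f x - mu / 2 * enorm x ^+ 2).

Definition is_minimizer (R : realType) (d : nat) (f : 'rV[R]_d -> R)
    (xs : 'rV[R]_d) : Prop := forall x, f xs <= f x.

Fixpoint gd_iterate (R : realType) (d : nat) (f : 'rV[R]_d -> R) (alpha : R)
    (x0 : 'rV[R]_d) (w : nat -> 'rV[R]_d) (k : nat) : 'rV[R]_d :=
  if k is k'.+1 then
    let x := gd_iterate f alpha x0 w k' in x - alpha *: (grad f x + w k')
  else x0.

Definition square_summable (R : realType) (d : nat) (w : nat -> 'rV[R]_d) :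
  Prop := (\sum_(0 <= k <oo) (enorm (w k) ^+ 2)%:E < +oo)%E.

Definition is_l2_gain_bound (R : realType) (d : nat) (f : 'rV[R]_d -> R)
    (alpha : R) (xs : 'rV[R]_d) (gamma : R) : Prop :=
  0 < gamma /\
  exists H : 'rV[R]_d -> R,
    [/\ forall x, 0 <= H x,
        H xs = 0 &
        forall (x0 : 'rV[R]_d) (w : nat -> 'rV[R]_d), square_summable w ->
          (\sum_(0 <= k <oo) (f (gd_iterate f alpha x0 w k) - f xs)%:E <=
           (gamma ^+ 2)%:E * \sum_(0 <= k <oo) (enorm (w k) ^+ 2)%:E
             + (H x0)%:E)%E].

(* Extended-real infimum: the value is +oo when no gamma is admissible, whereas
   the real-valued inf of the empty set would be 0. *)
Definition l2_gain (R : realType) (d : nat) (f : 'rV[R]_d -> R) (alpha : R)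
    (xs : 'rV[R]_d) : \bar R :=
  ereal_inf [set gamma%:E | gamma in is_l2_gain_bound f alpha xs].

(* Main.v *)
Require Import Defs.
From HB Require Import structures.
From mathcomp Require Import all_boot all_order all_algebra.
From mathcomp Require Import all_classical all_reals all_analysis.
From mathcomp Require Import ring lra.
Import Order.TTheory GRing.Theory Num.Theory.
Import numFieldNormedType.Exports.
Local Open Scope ring_scope.

(** Every bound comes from a storage function V >= 0 with V xs = 0 for which
    one perturbed step x' satisfies the dissipation inequality
      V x' + c * (f x - f xs) <= V x + c * gamma ^+ 2 * |w| ^+ 2.
    Summed along the iterates, the values of V telescope, and V / c serves as
    the initialization term (l2_gain_le_of_dissipation).  Two storage functions
    suffice.

    For small steps, V is the gap f - f xs.  The descent lemma bounds f x' by a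
    quadratic in grad f x and w; Young's inequality with a free weight t > 0
    removes the cross term, whose coefficient is alpha * (alpha * L - 1), and
    the Polyak-Lojasiewicz inequality turns |grad f x| ^+ 2 back into the gap.
    With a = alpha * L and b = |a - 1| this yields
      2 * mu * gamma ^+ 2 = (a + b / t) / (2 - a - b * t).
    For a <= 1 the weight t = 1 makes the right-hand side 1; for a > 1 its
    minimizer t = (2 - a) / a makes it (a / (2 - a)) ^+ 2.

    For large steps, V is the squared distance to xs.  An exact gradient step
    contracts the distance by rho = max (1 - alpha * mu) (alpha * L - 1), by
    cocoercivity of the gradient.  Squaring |x' - xs| <= rho |x - xs| +
    alpha |w| with Young's inequality and using f - f xs <= L / 2 |x - xs| ^+ 2
    gives gamma = sqrt (L / 2) * alpha / (1 - rho).  The step 2 / (L + mu) is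
    where the two candidates for rho coincide, and at 2 / (L + sqrt (L * mu))
    the bounds from the two storage functions agree.

    The only input from analysis is the two-sided descent lemma; together with
    strong convexity it implies all the other inequalities by algebra. *)

(** * Euclidean inner product *)

Section InnerProduct.
Set Implicit Arguments.
Unset Strict Implicit.

Lemma addlK (V : zmodType) (x y : V) : x + y - x = y.
Proof. by rewrite addrC addKr. Qed.

Context {R : realType} {d : nat}.
Implicit Types (u v w : 'rV[R]_d) (a : R).

Definition dot u v : R := \sum_(i < d) u 0 i * v 0 i.

Lemma dotC u v : dot u v = dot v u.
Proof. by apply: eq_bigr => i _; rewrite mulrC. Qed.

Lemma dotDl u v w : dot (u + v) w = dot u w + dot v w.
Proof. by rewrite -big_split; apply: eq_bigr => i _; rewrite mxE mulrDl. Qed.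

Lemma dotZl a u v : dot (a *: u) v = a * dot u v.
Proof. by rewrite /dot mulr_sumr; apply: eq_bigr => i _; rewrite mxE mulrA. Qed.

Lemma dot0l v : dot 0 v = 0.
Proof. by rewrite -(scale0r 0) dotZl mul0r. Qed.

Lemma dotNl u v : dot (- u) v = - dot u v.
Proof. by rewrite -scaleN1r dotZl mulN1r. Qed.

Lemma dotDr u v w : dot w (u + v) = dot w u + dot w v.
Proof. by rewrite dotC dotDl !(dotC w). Qed.

Lemma dotZr a u v : dot u (a *: v) = a * dot u v.
Proof. by rewrite dotC dotZl dotC. Qed.

Lemma dotNr u v : dot u (- v) = - dot u v.
Proof. by rewrite dotC dotNl dotC. Qed.

Definition dotE := (dotDl, dotDr, dotNl, dotNr, dotZl, dotZr).

Lemma dot_ge0 u : 0 <= dot u u.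
Proof. by apply: sumr_ge0 => i _; rewrite -expr2 sqr_ge0. Qed.

Lemma enorm_sqr u : enorm u ^+ 2 = dot u u.
Proof.
rewrite /enorm sqr_sqrtr; last by apply: sumr_ge0 => i _; exact: sqr_ge0.
by apply: eq_bigr => i _; rewrite expr2.
Qed.

(** The case of Cauchy-Schwarz needed below, read off from the squares
    |u - K v|^2 >= 0 and |u + K v|^2 >= 0. *)
Lemma abs_dot_le (K : R) u v : 0 < K -> dot u u <= K ^+ 2 * dot v v ->
  `|dot u v| <= K * dot v v.
Proof.
move=> K0 uv.
have := dot_ge0 (u - K *: v); have := dot_ge0 (u + K *: v).
rewrite !dotE (dotC v u) => h1 h2.
rewrite ler_norml; apply/andP; split.
  rewrite -(ler_pM2l K0); nra.
rewrite -(ler_pM2l K0); nra.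
Qed.

End InnerProduct.

(** * Smooth functions and their minimizers *)

Section Smooth.
Set Implicit Arguments.
Unset Strict Implicit.
Context {R : realType} {d : nat}.
Variables (L : R) (f : 'rV[R]_d -> R).
Hypotheses (L0 : 0 < L) (fL : smooth L f).

Lemma derive_grad x v : 'D_v f x = dot (grad f x) v.
Proof.
have [df _ _] := fL.
rewrite deriveE // [in LHS](row_sum_delta v) linear_sum.
apply: eq_bigr => i _.
by rewrite linearZ /= mxE deriveE // mulrC.
Qed.

(** The difference quotients of f along the line coincide with those that
    define the directional derivative, so no chain rule is involved. *)
Lemma is_derive_line (x v : 'rV[R]_d) (t : R) :
  is_derive t (1 : R) (fun s : R => f (x + s *: v))
    (dot (grad f (x + t *: v)) v).
Proof.
have [df _ _] := fL.
have dv : derivable f (x + t *: v) v by exact: diff_derivable.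
have E : (fun h : R => h^-1 *: (((fun s : R => f (x + s *: v)) \o shift t)
      (h *: (1 : R)) - f (x + t *: v))) =
    (fun h : R => h^-1 *: ((f \o shift (x + t *: v)) (h *: v)
      - f (x + t *: v))).
  apply/funext => h /=; congr (_ *: (f _ - _)).
  by rewrite [h *: 1]mulr1 scalerDl addrCA.
rewrite -derive_grad; apply: DeriveDef.
  by rewrite /derivable E.
by rewrite /derive E.
Qed.

(** The mean value theorem, applied to the restriction of f to the segment
    minus its affine part and minus L / 2 |v|^2 t^2, whose derivative is
    nonpositive because the gradient moves by at most L t |v| at time t.  The
    lower bound is used as well: it replaces a limit in the passage from
    strong convexity to its first-order form. *)
Lemma descent_lemma (x y : 'rV[R]_d) :
  `|f y - f x - dot (grad f x) (y - x)| <= L / 2 * dot (y - x) (y - x).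
Proof.
have [df _ gL] := fL.
set v := y - x; have xv : x + v = y by rewrite addrC subrK.
(* The sign s treats the upper and the lower bound at once. *)
have key (s : R) : s ^+ 2 = 1 ->
    s * (f y - f x - dot (grad f x) v) <= L / 2 * dot v v.
  move=> s1.
  pose phi t := s * (f (x + t *: v) - t * dot (grad f x) v)
     - L / 2 * dot v v * t ^+ 2.
  have dphi (t : R) : is_derive t (1:R) phi
     (s * (dot (grad f (x + t *: v)) v - dot (grad f x) v) - L * dot v v * t).
    have := is_derive_line x v t => hl.
    apply: is_derive_eq; rewrite /GRing.scale /=.
    by field.
  have [|c] := @MVT R phi _ 0 1 ltr01 (fun t _ => dphi t).
    by apply: derivable_within_continuous => t _; apply: ex_derive.
  rewrite in_itv /= => /andP[c0 c1].
  rewrite /phi scale1r scale0r addr0 xv.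
  have := @abs_dot_le R d (L * c) (grad f (x + c *: v) - grad f x) v.
  rewrite mulr_gt0 // => /(_ isT).
  have -> : dot (grad f (x + c *: v) - grad f x)
      (grad f (x + c *: v) - grad f x) <= (L * c) ^+ 2 * dot v v.
    have := gL (x + c *: v) x.
    rewrite addlK => h.
    have {h} : enorm (grad f (x + c *: v) - grad f x) ^+ 2 <=
        (L * enorm (c *: v)) ^+ 2.
      by rewrite ler_pXn2r // nnegrE ?mulr_ge0 ?sqrtr_ge0 // ltW.
    rewrite exprMn !enorm_sqr !dotE => /le_trans; apply.
    by rewrite le_eqVlt; apply/orP; left; apply/eqP; ring.
  move=> /(_ isT); rewrite !dotE.
  have : (s == 1) || (s == -1) by rewrite -eqf_sqr s1 expr1n.
  rewrite ler_norml => /orP[]/eqP -> /andP[h1 h2] h3; nra.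
rewrite ler_norml; apply/andP; split.
  by have := key (-1); rewrite sqrrN expr1n => /(_ erefl); lra.
by have := key 1 (expr1n _ _); lra.
Qed.

Variable xs : 'rV[R]_d.
Hypothesis xsmin : is_minimizer f xs.

(** A gradient step of length 1 / L lowers f by at least |grad f|^2 / (2 L). *)
Lemma grad_minimizer : grad f xs = 0.
Proof.
set g := grad f xs.
have := descent_lemma xs (xs - L^-1 *: g); rewrite addlK ler_norml => /andP[_].
have := xsmin (xs - L^-1 *: g); have := dot_ge0 g.
rewrite !dotE -/g => g0 h1 h2.
have gg : dot g g = 0.
  apply/eqP; rewrite eq_le g0 andbT.
  have : 0 <= - (L^-1 * dot g g) / 2.
    have -> : - (L^-1 * dot g g) / 2 =
      L / 2 * (- (L^-1 * - (L^-1 * dot g g))) - (L^-1 * dot g g).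
      by field; rewrite gt_eqF.
    lra.
  have Li : 0 < L^-1 by rewrite invr_gt0.
  nra.
apply/rowP => i; rewrite [RHS]mxE; apply/eqP; rewrite -sqrf_eq0 expr2.
apply/eqP; move: gg => /psumr_eq0P -> // j _.
by rewrite -expr2 sqr_ge0.
Qed.

Lemma gap_le_dist x : f x - f xs <= L / 2 * dot (x - xs) (x - xs).
Proof.
have := descent_lemma xs x.
by rewrite grad_minimizer dot0l subr0 => /(le_trans (ler_norm _)).
Qed.

End Smooth.

(** * Strongly convex smooth functions *)

Section StronglyConvex.
Set Implicit Arguments.
Unset Strict Implicit.
Context {R : realType} {d : nat}.
Variables (mu L : R) (f : 'rV[R]_d -> R) (xs : 'rV[R]_d).
Hypotheses (mu0 : 0 < mu) (muL : mu < L).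
Hypotheses (fmu : strongly_convex mu f) (fL : smooth L f).
Hypothesis (xsmin : is_minimizer f xs).

Let L0 : 0 < L. Proof. exact: lt_trans muL. Qed.

(** Convexity on the segment from x to x + v bounds f (x + t v) from above and
    the descent lemma bounds it from below.  Dividing by t gives the claim up
    to an error t * (mu + L) / 2 |v|^2, which vanishes with t. *)
Lemma strong_convexity_lower_bound (x y : 'rV[R]_d) :
  f x + dot (grad f x) (y - x) + mu / 2 * dot (y - x) (y - x) <= f y.
Proof.
have [v ->] : exists v, y = x + v by exists (y - x); rewrite addrC subrK.
rewrite addlK; have V0 := dot_ge0 v.
have key (t : R) : 0 < t -> t <= 1 ->
    dot (grad f x) v <= f (x + v) - f x - mu / 2 * dot v v
      + t * ((mu + L) / 2 * dot v v).
  move=> t0 t1.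
  have : f (t *: (x + v) + (1 - t) *: x) -
      mu / 2 * enorm (t *: (x + v) + (1 - t) *: x) ^+ 2 <=
      t * (f (x + v) - mu / 2 * enorm (x + v) ^+ 2)
      + (1 - t) * (f x - mu / 2 * enorm x ^+ 2).
    by apply: (fmu (Itv01 (ltW t0) t1)); exact: in_setT.
  have -> : t *: (x + v) + (1 - t) *: x = x + t *: v.
    by rewrite scalerDr scalerBl scale1r addrAC addrCA subrr addr0 addrC.
  rewrite !enorm_sqr => h.
  have := descent_lemma L0 fL x (x + t *: v).
  rewrite addlK ler_norml => /andP[h2 _].
  move: h h2; rewrite !dotE (dotC v x) => h1 h2.
  rewrite -(ler_pM2l t0); nra.
(* If the claim fails by del > 0, the value t = del / (C + del) makes the
   error t * C smaller than del. *)
rewrite leNgt; apply/negP => lt.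
pose C := (mu + L) / 2 * dot v v.
pose del := f x + dot (grad f x) v + mu / 2 * dot v v - f (x + v).
have del0 : 0 < del by rewrite /del; lra.
have C0 : 0 <= C by rewrite /C mulr_ge0 // divr_ge0 // addr_ge0 // ltW.
have Cd0 : 0 < C + del by rewrite ltr_wpDl.
have := key (del / (C + del)); rewrite divr_gt0 // ler_pdivrMr // mul1r lerDr.
move=> /(_ isT C0); rewrite -/C => h.
have : del <= del / (C + del) * C by rewrite /del in h *; lra.
rewrite mulrAC ler_pdivlMr // => {}h; nra.
Qed.

(** Minimizing the strong convexity lower bound at x over its free point: the
    minimum is at least f x - |grad f x|^2 / (2 mu). *)
Lemma polyak_lojasiewicz (x : 'rV[R]_d) :
  2 * mu * (f x - f xs) <= dot (grad f x) (grad f x).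
Proof.
have := strong_convexity_lower_bound x xs.
have := dot_ge0 (grad f x - mu *: (x - xs)).
rewrite -(opprB x xs); move: (x - xs) => v.
rewrite !dotE (dotC v) => h1 h2.
have {}h2 : 0 <= mu * (f xs - f x + dot (grad f x) v - mu / 2 * dot v v).
  by rewrite mulr_ge0 ?(ltW mu0) //; lra.
lra.
Qed.

Lemma gap_ge_dist x : mu / 2 * dot (x - xs) (x - xs) <= f x - f xs.
Proof.
have := strong_convexity_lower_bound xs x.
by rewrite (grad_minimizer L0 fL xsmin) dot0l addr0 lerBrDl.
Qed.

(** The cocoercivity of the gradient of f - mu / 2 |.|^2, which is convex with
    (L - mu)-Lipschitz gradient, between x and xs. *)
Lemma cocoercivity x :
  mu * L * dot (x - xs) (x - xs) + dot (grad f x) (grad f x) <=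
    (mu + L) * dot (grad f x) (x - xs).
Proof.
set g := grad f x; set v := x - xs.
have m0 : 0 < L - mu by rewrite subr_gt0.
pose k := (L - mu)^-1; have k0 : 0 < k by rewrite invr_gt0.
pose u := g - mu *: v.
(* u is the difference of the gradients at x and xs of f - mu / 2 |.|^2.  The
   points z and y are the steps of length k against it from x and along it from
   xs; sandwiching f at both between the smooth upper bound from one base
   point and the strongly convex lower bound from the other, and adding up,
   gives k |u|^2 <= <u, v>. *)
pose z := x - k *: u; pose y := xs + k *: u.
have zx : z - x = - (k *: u) by rewrite /z addlK.
have yxs : y - xs = k *: u by rewrite /y addlK.
have zxs : z - xs = v - k *: u by rewrite /z addrAC.
have yx : y - x = k *: u - v by rewrite /y addrAC -(opprB x) addrC.
have := gap_ge_dist z; have := gap_le_dist L0 fL xsmin y.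
have := descent_lemma L0 fL x z; have := strong_convexity_lower_bound x y.
rewrite zx yxs zxs yx -/g ler_norml => h1 /andP[_ h2] h3 h4.
have gE : g = u + mu *: v by rewrite subrK.
clearbody y z u g v; move: h1 h2 h3 h4; rewrite gE !dotE (dotC v u).
have E : L * (k * k * dot u u) = mu * (k * k * dot u u) + dot u u * k.
  by rewrite /k; field; rewrite gt_eqF.
move=> h1 h2 h3 h4; have {h1 h2 h3 h4 E} : dot u u * k <= dot u v by lra.
rewrite ler_pdivrMr // => uv; nra.
Qed.

Lemma grad_dist_bounds x :
  mu * dot (x - xs) (x - xs) <= dot (grad f x) (x - xs) <=
    L * dot (x - xs) (x - xs).
Proof.
have := gap_le_dist L0 fL xsmin x; have := gap_ge_dist x.
have := descent_lemma L0 fL x xs; have := strong_convexity_lower_bound x xs.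
rewrite -(opprB x xs); move: (x - xs) => v; rewrite ler_norml !dotE opprK.
move=> h1 /andP[_ h2] h3 h4; apply/andP; split; lra.
Qed.

(** Cocoercivity eliminates |grad f x|^2 from the expanded square.  What is left
    is affine in <grad f x, x - xs>, with a slope whose sign is that of
    alpha * (mu + L) - 2; this sign decides which end of the range given by
    grad_dist_bounds is extremal, and hence which rate appears. *)
Lemma gradient_step_contraction (alpha rho : R) (x : 'rV[R]_d) :
  0 < alpha -> 1 - alpha * mu <= rho -> alpha * L - 1 <= rho ->
  dot (x - alpha *: grad f x - xs) (x - alpha *: grad f x - xs) <=
    rho ^+ 2 * dot (x - xs) (x - xs).
Proof.
move=> a0 r1 r2.
have -> : x - alpha *: grad f x - xs = (x - xs) - alpha *: grad f x.
  by rewrite addrAC.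
have := cocoercivity x; have /andP[] := grad_dist_bounds x.
have := dot_ge0 (x - xs).
move: (x - xs) (grad f x) => v g; rewrite !dotE (dotC v g).
move: (dot v v) (dot g v) (dot g g) => V s G V0 h1 h2 h3.
have h4 : alpha ^+ 2 * G <= alpha ^+ 2 * ((mu + L) * s - mu * L * V).
  by rewrite ler_pM2l ?exprn_gt0 // lerBrDl.
have aLmu : alpha * mu < alpha * L by rewrite ltr_pM2l.
have [le|lt] := leP (alpha * (mu + L)) 2.
  have {}r1 : (1 - alpha * mu) ^+ 2 * V <= rho ^+ 2 * V.
    by rewrite ler_wpM2r // ler_pXn2r ?nnegrE //; lra.
  have := ler_wpM2l (_ : 0 <= alpha * (2 - alpha * (mu + L))) h1.
  rewrite mulr_ge0 ?(ltW a0) ?subr_ge0 // => /(_ isT); lra.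
have {}r2 : (alpha * L - 1) ^+ 2 * V <= rho ^+ 2 * V.
  by rewrite ler_wpM2r // ler_pXn2r ?nnegrE //; lra.
have := ler_wpM2l (_ : 0 <= alpha * (alpha * (mu + L) - 2)) h2.
rewrite mulr_ge0 ?(ltW a0) ?subr_ge0 ?(ltW lt) // => /(_ isT); lra.
Qed.

(** Young's inequality in the form
    (rho p + q)^2 <= rho p^2 + q^2 / (1 - rho), with p = |x - xs| and
    q = alpha |w|. *)
Lemma dist_dissipation (alpha rho : R) (x w : 'rV[R]_d) :
  0 < alpha -> 0 < rho -> rho < 1 ->
  1 - alpha * mu <= rho -> alpha * L - 1 <= rho ->
  let x' := x - alpha *: (grad f x + w) in
  dot (x' - xs) (x' - xs) + (1 - rho) * dot (x - xs) (x - xs) <=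
   dot (x - xs) (x - xs) + alpha ^+ 2 / (1 - rho) * dot w w.
Proof.
move=> a0 r0 r1 r2 r3 /=.
have := gradient_step_contraction x a0 r2 r3.
have -> : x - alpha *: (grad f x + w) - xs =
    x - alpha *: grad f x - xs - alpha *: w.
  by rewrite scalerDr opprD addrA [RHS]addrAC.
move: (dot (x - xs) _) (x - alpha *: grad f x - xs) => V p h.
have r1' : 0 < 1 - rho by rewrite subr_gt0.
have := dot_ge0 ((1 - rho) *: p + (rho * alpha) *: w).
rewrite !dotE (dotC w p); move: (dot p p) (dot p w) (dot w w) h => P s W h1 h2.
have {}h1 : (1 - rho) * P <= (1 - rho) * (rho ^+ 2 * V) by rewrite ler_pM2l.
rewrite -(ler_pM2l (mulr_gt0 r0 r1')).
have -> : rho * (1 - rho) * (V + alpha ^+ 2 / (1 - rho) * W) =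
  rho * (1 - rho) * V + rho * alpha ^+ 2 * W.
  by field; rewrite gt_eqF.
nra.
Qed.

(** The weight t splits the cross term (a - 1) <grad f x, w> between the two
    squares; it is left free so that it can be optimized for each stepsize. *)
Lemma gap_dissipation (alpha t : R) (x w : 'rV[R]_d) :
  0 < alpha -> 0 < t ->
  let a := alpha * L in let b := `|a - 1| in
  0 <= 2 - a - b * t ->
  let x' := x - alpha *: (grad f x + w) in
  (f x' - f xs) + alpha * mu * (2 - a - b * t) * (f x - f xs) <=
   (f x - f xs) + alpha / 2 * (a + b / t) * dot w w.
Proof.
move=> a0 t0 a b c0 /=.
set y := x - _; have yx : y - x = - (alpha *: (grad f x + w)) by rewrite addlK.
have := descent_lemma L0 fL x y; rewrite yx ler_norml => /andP[_].
have := polyak_lojasiewicz x; have := dot_ge0 (t *: grad f x + w).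
have := dot_ge0 (t *: grad f x - w).
move: (f y) (f x) (f xs) (grad f x) => fy fx fs g.
rewrite !dotE !(dotC w g); move: (dot g g) (dot g w) (dot w w) => G s W.
move=> h1 h2 h3 h4.
have h5 : `|s| <= (t * G + W / t) / 2.
  have tt : t * (W / t) = W by rewrite mulrC divfK ?gt_eqF.
  by rewrite ler_norml; apply/andP; split; rewrite -(ler_pM2l t0); lra.
have h6 : (a - 1) * s <= b * ((t * G + W / t) / 2).
  apply: le_trans (ler_norm _) _; rewrite normrM.
  by apply: ler_wpM2l h5.
have h7 : alpha * ((a - 1) * s) <= alpha * (b * ((t * G + W / t) / 2)).
  by rewrite ler_wpM2l // ltW.
have h8 : alpha / 2 * (2 - a - b * t) * (2 * mu * (fx - fs)) <=
       alpha / 2 * (2 - a - b * t) * G.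
  by rewrite ler_wpM2l // mulr_ge0 // divr_ge0 // ltW.
clearbody b; rewrite /a in h7 h8 *; lra.
Qed.

End StronglyConvex.

(** * Gain bounds from storage functions *)

Section Gain.
Set Implicit Arguments.
Unset Strict Implicit.
Context {R : realType} {d : nat}.
Variables (f : 'rV[R]_d -> R) (alpha : R) (xs : 'rV[R]_d).
Hypothesis (xsmin : is_minimizer f xs).

Lemma l2_gain_le_of_dissipation (V : 'rV[R]_d -> R) (c gamma : R) :
  0 < c -> 0 < gamma -> (forall x, 0 <= V x) -> V xs = 0 ->
  (forall x w, V (x - alpha *: (grad f x + w)) + c * (f x - f xs) <=
     V x + c * gamma ^+ 2 * dot w w) ->
  (l2_gain f alpha xs <= gamma%:E)%E.
Proof.
move=> c0 g0 V0 Vxs step; apply: ereal_inf_lbound; exists gamma => //.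
split=> //; exists (fun x => V x / c); split.
- by move=> x; rewrite divr_ge0 // ltW.
- by rewrite Vxs mul0r.
move=> x0 w _; set x := gd_iterate f alpha x0 w.
have fin n : \sum_(0 <= k < n) (f (x k) - f xs) <=
    gamma ^+ 2 * \sum_(0 <= k < n) enorm (w k) ^+ 2 + V x0 / c.
  suff h : V (x n) + c * \sum_(0 <= k < n) (f (x k) - f xs) <=
      c * gamma ^+ 2 * \sum_(0 <= k < n) enorm (w k) ^+ 2 + V x0.
    rewrite -(ler_pM2l c0) mulrDr mulrA [c * (_ / c)]mulrC divfK ?gt_eqF //.
    by apply: le_trans h; rewrite lerDr.
  elim: n => [|n IH]; first by rewrite !big_nil !mulr0 add0r addr0.
  rewrite !big_nat_recr //= enorm_sqr; have := step (x n) (w n).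
  rewrite -/x; lra.
apply: lime_le.
  by apply: is_cvg_nneseries => n _ _; rewrite lee_fin subr_ge0.
apply: nearW => n; rewrite sumEFin.
have /le_trans : ((\sum_(0 <= k < n) (f (x k) - f xs))%:E <=
    (gamma ^+ 2 * \sum_(0 <= k < n) enorm (w k) ^+ 2 + V x0 / c)%:E)%E.
  by rewrite lee_fin.
apply.
rewrite EFinD EFinM -sumEFin leeD2r // lee_pmul2l //.
- by apply: nneseries_lim_ge => k _ _; rewrite lee_fin sqr_ge0.
- by rewrite lte_fin exprn_gt0.
Qed.

Section Rates.
Variables (mu L : R).
Hypotheses (mu0 : 0 < mu) (muL : mu < L).
Hypotheses (fmu : strongly_convex mu f) (fL : smooth L f) (alpha0 : 0 < alpha).

Lemma l2_gain_le_of_gap (t : R) : 0 < t ->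
  let a := alpha * L in let b := `|a - 1| in
  0 < 2 - a - b * t -> forall gamma : R, 0 < gamma ->
  (a + b / t) / (2 - a - b * t) = (2 * mu) * gamma ^+ 2 ->
  (l2_gain f alpha xs <= gamma%:E)%E.
Proof.
move=> t0 a b c0 gamma g0 gE.
apply: (@l2_gain_le_of_dissipation (fun x => f x - f xs)
   (alpha * mu * (2 - a - b * t))) => //.
- by rewrite !mulr_gt0.
- by move=> x; rewrite subr_ge0.
- by rewrite subrr.
move=> x w; have := gap_dissipation xs mu0 muL fmu fL x w alpha0 t0 (ltW c0).
rewrite -/a -/b; move: gE => /(canRL (divfK (lt0r_neq0 c0))) ->.
by move/le_trans; apply; rewrite le_eqVlt; apply/orP; left; apply/eqP; field.
Qed.

Lemma l2_gain_le_of_dist (rho : R) : 0 < rho -> rho < 1 ->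
  1 - alpha * mu <= rho -> alpha * L - 1 <= rho ->
  forall gamma : R, 0 < gamma ->
  2 * gamma ^+ 2 = L * (alpha / (1 - rho)) ^+ 2 ->
  (l2_gain f alpha xs <= gamma%:E)%E.
Proof.
move=> r0 r1 r2 r3 gamma g0 gE.
have L0 : 0 < L by exact: lt_trans muL.
have r1' : 0 < 1 - rho by rewrite subr_gt0.
apply: (@l2_gain_le_of_dissipation (fun x => dot (x - xs) (x - xs))
   ((1 - rho) * (2 / L))) => //.
- by rewrite mulr_gt0 // divr_gt0.
- by move=> x; exact: dot_ge0.
- by rewrite subrr dot0l.
move=> x w.
have := dist_dissipation mu0 muL fmu fL xsmin x w alpha0 r0 r1 r2 r3.
have := gap_le_dist L0 fL xsmin x.
have -> : (1 - rho) * (2 / L) * gamma ^+ 2 = alpha ^+ 2 / (1 - rho).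
  have -> : (1 - rho) * (2 / L) * gamma ^+ 2 = (1 - rho) / L * (2 * gamma ^+ 2).
    by ring.
  by rewrite gE; field; rewrite !gt_eqF.
move=> h1 /=; apply: le_trans; rewrite lerD2l -mulrA ler_wpM2l ?(ltW r1') //.
by rewrite mulrAC ler_pdivrMr //; lra.
Qed.

End Rates.
End Gain.

Theorem proposition5p1 (R : realType) (d : nat) (mu L alpha : R)
    (f : 'rV[R]_d -> R) (xs : 'rV[R]_d)
    (mu_gt0 : 0 < mu) (mu_lt_L : mu < L)
    (f_sc : strongly_convex mu f) (f_smooth : smooth L f)
    (xs_min : is_minimizer f xs)
    (alpha_gt0 : 0 < alpha) (alpha_lt : alpha < 2 / L) :
  let kappa := L / mu in
  [/\ 0 < alpha <= 1 / L ->
        (l2_gain f alpha xs <= (1 / Num.sqrt (2 * mu))%:E)%E,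
      1 / L < alpha <= 2 / (L + Num.sqrt (L * mu)) ->
        (l2_gain f alpha xs <=
          (1 / Num.sqrt (2 * mu) * (alpha * L / (2 - alpha * L)))%:E)%E,
      2 / (L + Num.sqrt (L * mu)) < alpha <= 2 / (L + mu) ->
        (l2_gain f alpha xs <=
          (1 / Num.sqrt (2 * mu) * Num.sqrt kappa)%:E)%E &
      2 / (L + mu) < alpha < 2 / L ->
        (l2_gain f alpha xs <=
          (alpha * Num.sqrt L / (Num.sqrt 2 * (2 - alpha * L)))%:E)%E].
Proof.
move=> kappa.
have L0 : 0 < L by exact: lt_trans mu_lt_L.
have a2 : alpha * L < 2 by rewrite -ltr_pdivlMr.
have s0 : 0 < Num.sqrt (2 * mu) by rewrite sqrtr_gt0 mulr_gt0.
have sE : Num.sqrt (2 * mu) ^+ 2 = 2 * mu.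
  by rewrite sqr_sqrtr // mulr_ge0 // ltW.
have k0 : 0 < kappa by rewrite divr_gt0.
have mL0 : 0 < L + mu by rewrite addr_gt0.
have gain_gap :=
  l2_gain_le_of_gap xs_min mu_gt0 mu_lt_L f_sc f_smooth alpha_gt0.
have gain_dist :=
  l2_gain_le_of_dist xs_min mu_gt0 mu_lt_L f_sc f_smooth alpha_gt0.
have n2 : 2 - alpha * L != 0 by rewrite gt_eqF // subr_gt0.
split.
- move=> /andP[_]; rewrite ler_pdivlMr // => a1.
  have bE : `|alpha * L - 1| = 1 - alpha * L.
    by rewrite ler0_norm ?opprB ?subr_le0.
  apply: (gain_gap 1); rewrite ?bE ?divr_gt0 //; first lra.
  by rewrite expr_div_n sE; field; rewrite gt_eqF //; lra.
- move=> /andP[]; rewrite ltr_pdivrMr // => a1 _.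
  have bE : `|alpha * L - 1| = alpha * L - 1 by rewrite gtr0_norm // subr_gt0.
  have a0 : 0 < alpha * L by rewrite mulr_gt0.
  have d0 : 0 < 2 - alpha * L by rewrite subr_gt0.
  (* The weight (2 - a) / a minimizes the resulting gain when a > 1. *)
  have dE : 2 - alpha * L - (alpha * L - 1) * ((2 - alpha * L) / (alpha * L)) =
      (2 - alpha * L) / (alpha * L) by field; rewrite !gt_eqF.
  apply: (gain_gap ((2 - alpha * L) / (alpha * L))); rewrite ?bE ?dE.
  + by rewrite divr_gt0.
  + by rewrite divr_gt0.
  + by rewrite mulr_gt0 // divr_gt0.
  by rewrite exprMn expr_div_n sE; field; rewrite !gt_eqF.
- move=> /andP[_]; rewrite ler_pdivlMr // => a1.
  have aLmu : alpha * mu < alpha * L by rewrite ltr_pM2l.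
  apply: (gain_dist (1 - alpha * mu)) => //; try lra.
  + by rewrite ltrBlDr ltrDl mulr_gt0.
  + by rewrite mulr_gt0 // ?divr_gt0 // sqrtr_gt0.
  rewrite exprMn expr_div_n sE sqr_sqrtr ?(ltW k0) // /kappa subKr.
  by field; rewrite !gt_eqF.
- move=> /andP[]; rewrite ltr_pdivrMr // => a1 _.
  have aLmu : alpha * mu < alpha * L by rewrite ltr_pM2l.
  apply: (gain_dist (alpha * L - 1)) => //; try lra.
  + by rewrite divr_gt0 ?mulr_gt0 ?sqrtr_gt0 ?subr_gt0.
  rewrite expr_div_n !exprMn !sqr_sqrtr ?(ltW L0) //.
  have -> : 1 - (alpha * L - 1) = 2 - alpha * L by lra.
  by field.
Qed.
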